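(* Let $\mathcal L$ be one of the Magic Star algebras $\mathbf{e}_6^{(n)},\mathbf{e}_7^{(n)},\mathbf{e}_8^{(n)}$, $n\ge 1$, over $\mathfrak F$. Then $\mathcal L$ has a five-graded structure. Namely, with $\mathfrak g_{III}=\mathfrak g_0\oplus\mathfrak F h_{k_1+k_2-2k_3}\oplus T_{(0,2)}\oplus T_{(0,-2)}$, $\mathbf C=\mathfrak F h_{k_1-k_2}$, $$F^+=T_{(1,1)}+1_{(1,3)}+T_{(1,-1)}+1_{(1,-3)},\qquad F^-=T_{(-1,1)}+1_{(-1,3)}+T_{(-1,-1)}+1_{(-1,-3)},$$ one has $$\mathcal L=(\mathfrak g_{III}\oplus\mathbf C)\oplus F^+\oplus F^-\oplus 1_{(2,0)}\oplus 1_{(-2,0)},$$ and this is a 5-grading of $\mathcal L$ with the subalgebra $\mathfrak g_{III}\oplus\mathbf C$ in grade $0$, $F^{\pm}$ in grade $\pm1$, and $1_{(\pm2,0)}$ in grade $\pm2$.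
   Context: Notation. Let $\mathfrak F$ be a field of characteristic $0$, $n\ge1$ an integer, $N=4(n+1)$, and $k_1,\dots,k_N$ an orthonormal basis of a Euclidean space with scalar product $(\cdot,\cdot)$. The set of generalized roots is $\Phi=\Phi_O\cup\Phi_S$, where: - for $\mathbf e_8^{(n)}$ (rank $R=N$): $\Phi_O=\{\pm k_i\pm k_j: 1\le i<j\le N\}$, $\Phi_S=\{\frac12(\pm k_1\pm\dots\pm k_N)$ with an even number of $+$ signs$\}$; - for $\mathbf e_7^{(n)}$ (rank $R=N-1$): the elements of the set $\{\pm k_i\pm k_j: 1\le i<j\le N\}\cup\{\frac12(\pm k_1\pm\dots\pm k_N)$ with an even number of $+$ signs$\}$ (the generalized roots of $\mathbf e_8^{(n)}$) that are orthogonal to $k_{N-1}-k_N$, i.e. $\Phi_O=\{\pm k_i\pm k_j:1\le i<j\le N-2\}\cup\{\pm(k_{N-1}+k_N)\}$, $\Phi_S=\{\frac12(\pm k_1\pm\dots\pm k_{N-2}\pm(k_{N-1}+k_N))$ with an even number of $+$ signs$\}$; - for $\mathbf e_6^{(n)}$ (rank $R=N-2$): $\Phi_O=\{\pm k_i\pm k_j:1\le i<j\le N-3\}$, $\Phi_S=\{\frac12(\pm k_1\pm\dots\pm k_{N-3}\pm(k_{N-2}+k_{N-1}+k_N))$ with an even number of $+$ signs$\}$. The ordered simple generalized roots are $\alpha_i=k_i-k_{i+1}$ ($1\le i\le R-2$), $\alpha_{R-1}=k_{R-2}+k_{R-1}$, $\alpha_R=-\frac12(k_1+\dots+k_N)$,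 with $\alpha_i<\alpha_j$ for $i<j$. Every element of $\Phi$ is an integer combination of them. Let $\mathbb L=\bigoplus_i\mathbb Z\alpha_i$. The asymmetry function $\varepsilon:\mathbb L\times\mathbb L\to\{-1,1\}$ is $\varepsilon(\sum_i\ell_i\alpha_i,\sum_j m_j\alpha_j)=\prod_{i,j}\varepsilon(\alpha_i,\alpha_j)^{\ell_im_j}$, where $\varepsilon(\alpha_i,\alpha_j)=-1$ if $i=j$, $=-1$ if $\alpha_i+\alpha_j\in\Phi$ and $i<j$, and $=+1$ otherwise. The Magic Star algebra $\mathcal L$ is the (in general non-Lie) algebra over $\mathfrak F$ with basis $\{h_1,\dots,h_R\}\cup\{x_\alpha:\alpha\in\Phi\}$ and bilinear product given by $[h_i,h_j]=0$; $[h_i,x_\alpha]=-[x_\alpha,h_i]=(\alpha,\alpha_i)x_\alpha$; $[x_\alpha,x_{-\alpha}]=-h_\alpha$; $[x_\alpha,x_\beta]=0$ if $\alpha+\beta\notin\Phi$ and $\alpha\neq-\beta$; $[x_\alpha,x_\beta]=\varepsilon(\alpha,\beta)x_{\alpha+\beta}$ if $\alpha+\beta\in\Phi$. Here $h_\lambda:=\sum_ic_ih_i$ for $\lambda=\sum_ic_i\alpha_i\in\mathbb L$. Magic Star projection. To a root $\alpha$ assign $(r,s)=\big((\alpha,k_1-k_2),(\alpha,k_1+k_2-2k_3)\big)$. The roots $\pm(k_1-k_2),\pm(k_2-k_3),\pm(k_3-k_1)$ have $(r,s)=\pm(2,0),\pm(-1,3),\pm(-1,-3)$ respectively; all other roots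 have $(r,s)=(0,0)$ (the center of the Magic Star) or $(r,s)\in\{(\pm1,\pm1),(0,\pm2)\}$ with independent signs (the tips). For $(r,s)$ a tip, $T_{(r,s)}$ is the span of the $x_\alpha$ with $\alpha$ of type $(r,s)$. $\mathfrak g_0$ is the span of the $x_\alpha$ and $h_\alpha$ with $\alpha$ of type $(0,0)$. $1_{(r,s)}$ denotes the one-dimensional space spanned by $x_\alpha$ with $\alpha=\pm(k_2-k_3)$ for $(r,s)=\pm(-1,3)$, $\alpha=\pm(k_3-k_1)$ for $(r,s)=\pm(-1,-3)$, $\alpha=\pm(k_1-k_2)$ for $(r,s)=\pm(2,0)$. A 5-grading is a vector space decomposition $\mathcal L=\bigoplus_{i=-2}^{2}\mathfrak g_i$ with $[\mathfrak g_i,\mathfrak g_j]\subseteq\mathfrak g_{i+j}$, where $\mathfrak g_k=0$ for $|k|>2$. *)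

(* Defs.v *)
From HB Require Import structures.
From mathcomp Require Import all_boot all_order all_algebra.

Set Implicit Arguments.
Unset Strict Implicit.
Unset Printing Implicit Defensive.

Import Order.TTheory GRing.Theory Num.Theory.
Local Open Scope ring_scope.

Inductive magic_type : Type := e6 | e7 | e8.

Definition dimN (n : nat) : nat := (4 * n.+1)%N.

Definition ms_rank (t : magic_type) (n : nat) : nat :=
  match t with e6 => dimN n - 2 | e7 => dimN n - 1 | e8 => dimN n end.

(* The generalized roots have half-integral coordinates in the orthonormal
   basis k_1, ..., k_N, so the rational span of that basis, with its standard
   scalar product, is used as ambient Euclidean space. *)
Definition dot (n : nat) (u v : 'rV[rat]_(dimN n)) : rat := (u *m v^T) 0 0.

(* Indices are 1-based: kvec n i is k_i for 1 <= i <= N (and 0 otherwise). *)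
Definition kvec (n i : nat) : 'rV[rat]_(dimN n) := \row_j (j.+1 == i)%:R.

(* All +/- k_i +/- k_j with 1 <= i < j <= m. *)
Definition roots_D (n m : nat) : seq 'rV[rat]_(dimN n) :=
  [seq sg.1 *: kvec n ij.1 + sg.2 *: kvec n ij.2
    | sg <- [:: (1, 1); (1, -1); (-1, 1); (-1, -1)],
      ij <- [seq q <- [seq (i, j) | i <- iota 1 m, j <- iota 1 m]
               | (q.1 < q.2)%N]].

(* P is the set of the (0-based) positions carrying a + sign. *)
Definition spinor (n : nat) (P : {set 'I_(dimN n)}) : 'rV[rat]_(dimN n) :=
  2%:R^-1 *: \sum_(i < dimN n) (if i \in P then 1 else -1) *: kvec n i.+1.

(* The signs of k_{N-2}, k_{N-1}, k_N coincide. *)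
Definition last3_equal (n : nat) (P : {set 'I_(dimN n)}) : bool :=
  [forall i : 'I_(dimN n), forall j : 'I_(dimN n),
     (dimN n - 3 <= i)%N && (dimN n - 3 <= j)%N ==> ((i \in P) == (j \in P))].

Definition roots_e8 (n : nat) : seq 'rV[rat]_(dimN n) :=
  roots_D n (dimN n)
  ++ [seq spinor P | P <- enum [pred P : {set 'I_(dimN n)} | ~~ odd #|P|]].

Definition roots_e7 (n : nat) : seq 'rV[rat]_(dimN n) :=
  [seq a <- roots_e8 n | dot a (kvec n (dimN n - 1) - kvec n (dimN n)) == 0].

(* The parity of the number of + signs does not depend on whether the common
   sign of k_{N-2} + k_{N-1} + k_N is counted once or three times. *)
Definition roots_e6 (n : nat) : seq 'rV[rat]_(dimN n) :=
  roots_D n (dimN n - 3)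
  ++ [seq spinor P
       | P <- enum [pred P : {set 'I_(dimN n)}
                      | ~~ odd #|P| && last3_equal P]].

Definition Phi (t : magic_type) (n : nat) : seq 'rV[rat]_(dimN n) :=
  match t with e6 => roots_e6 n | e7 => roots_e7 n | e8 => roots_e8 n end.

(* alpha t n i is alpha_i for 1 <= i <= R. *)
Definition alpha (t : magic_type) (n i : nat) : 'rV[rat]_(dimN n) :=
  let R := ms_rank t n in
  if (i <= R - 2)%N then kvec n i - kvec n i.+1
  else if (i == R - 1)%N then kvec n (R - 2) + kvec n (R - 1)
  else - (2%:R^-1 *: \sum_(j < dimN n) kvec n j.+1).

Definition simple_roots (t : magic_type) (n : nat) :
    (ms_rank t n).-tuple 'rV[rat]_(dimN n) :=
  [tuple alpha t n i.+1 | i < ms_rank t n].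

(* The i-th integer coordinate of v in the simple roots, meaningful for v in
   the root lattice, where the rational coordinate is an integer and numq
   returns it unchanged. *)
Definition lcoord (t : magic_type) (n : nat) (v : 'rV[rat]_(dimN n))
    (i : 'I_(ms_rank t n)) : int :=
  numq (coord (simple_roots t n) i v).

Definition epsilon_simple (t : magic_type) (n : nat)
    (i j : 'I_(ms_rank t n)) : int :=
  if i == j then -1
  else if (alpha t n i.+1 + alpha t n j.+1 \in Phi t n) && (i < j)%N then -1
  else 1.

Definition epsilon (t : magic_type) (n : nat) (u v : 'rV[rat]_(dimN n)) : int :=
  \prod_(i < ms_rank t n) \prod_(j < ms_rank t n)
     epsilon_simple i j ^ (lcoord u i * lcoord v j).

(* The basis of the algebra is indexed by inl i (for h_(i+1)) and inr a (for
   x_a, with a a generalized root). *)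
Definition basis_index (t : magic_type) (n : nat) : finType :=
  ('I_(ms_rank t n) + seq_sub (Phi t n))%type.

Definition magic_star (F : fieldType) (t : magic_type) (n : nat) :
    vectType F :=
  {ffun basis_index t n -> F^o}.

Definition hgen (F : fieldType) (t : magic_type) (n : nat)
    (i : 'I_(ms_rank t n)) : magic_star F t n :=
  [ffun p : basis_index t n => (p == inl i)%:R : F^o].

(* The basis vector x_v, extended by 0 to v outside of Phi. *)
Definition xvec (F : fieldType) (t : magic_type) (n : nat)
    (v : 'rV[rat]_(dimN n)) : magic_star F t n :=
  [ffun p : basis_index t n =>
     (if p is inr b then (val b == v)%:R else 0) : F^o].

Definition hvec (F : fieldType) (t : magic_type) (n : nat)
    (v : 'rV[rat]_(dimN n)) : magic_star F t n :=
  \sum_(i < ms_rank t n) (lcoord v i)%:~R *: hgen F i.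

Definition bracket_basis (F : fieldType) (t : magic_type) (n : nat)
    (p q : basis_index t n) : magic_star F t n :=
  match p, q with
  | inl _, inl _ => 0
  | inl i, inr a => ratr (dot (val a) (alpha t n i.+1)) *: xvec F t (val a)
  | inr a, inl i => - (ratr (dot (val a) (alpha t n i.+1)) *: xvec F t (val a))
  | inr a, inr b =>
      if val a == - val b then - hvec F t (val a)
      else if val a + val b \in Phi t n
           then (epsilon t (val a) (val b))%:~R *: xvec F t (val a + val b)
      else 0
  end.

Definition bracket (F : fieldType) (t : magic_type) (n : nat)
    (u v : magic_star F t n) : magic_star F t n :=
  \sum_(p : basis_index t n) \sum_(q : basis_index t n)
     (u p * v q) *: bracket_basis F p q.

Definition has_type (n : nat) (r s : int) (v : 'rV[rat]_(dimN n)) : bool :=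
  (dot v (kvec n 1 - kvec n 2) == r%:~R)
  && (dot v (kvec n 1 + kvec n 2 - 2%:R *: kvec n 3) == s%:~R).

Definition tip (F : fieldType) (t : magic_type) (n : nat) (r s : int) :
    {vspace magic_star F t n} :=
  <<[seq xvec F t a | a <- Phi t n & has_type r s a]>>%VS.

Definition g_0 (F : fieldType) (t : magic_type) (n : nat) :
    {vspace magic_star F t n} :=
  <<[seq xvec F t a | a <- Phi t n & has_type 0 0 a]
    ++ [seq hvec F t a | a <- Phi t n & has_type 0 0 a]>>%VS.

(* The root labelled by the vertex (r,s) of the star, for (r,s) one of
   +/-(2,0), +/-(-1,3), +/-(-1,-3). *)
Definition star_vertex (n : nat) (r s : int) : 'rV[rat]_(dimN n) :=
  if (r, s) == (2, 0) then kvec n 1 - kvec n 2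
  else if (r, s) == (-2, 0) then - (kvec n 1 - kvec n 2)
  else if (r, s) == (-1, 3) then kvec n 2 - kvec n 3
  else if (r, s) == (1, -3) then - (kvec n 2 - kvec n 3)
  else if (r, s) == (-1, -3) then kvec n 3 - kvec n 1
  else if (r, s) == (1, 3) then - (kvec n 3 - kvec n 1)
  else 0.

Definition root_line (F : fieldType) (t : magic_type) (n : nat) (r s : int) :
    {vspace magic_star F t n} :=
  <[xvec F t (star_vertex n r s)]>%VS.

Definition g_III (F : fieldType) (t : magic_type) (n : nat) :
    {vspace magic_star F t n} :=
  (g_0 F t n + <[hvec F t (kvec n 1 + kvec n 2 - 2%:R *: kvec n 3)]>
   + tip F t n 0 2 + tip F t n 0 (-2))%VS.

Definition C_part (F : fieldType) (t : magic_type) (n : nat) :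
    {vspace magic_star F t n} :=
  <[hvec F t (kvec n 1 - kvec n 2)]>%VS.

Definition Fplus (F : fieldType) (t : magic_type) (n : nat) :
    {vspace magic_star F t n} :=
  (tip F t n 1 1 + root_line F t n 1 3 + tip F t n 1 (-1)
   + root_line F t n 1 (-3))%VS.

Definition Fminus (F : fieldType) (t : magic_type) (n : nat) :
    {vspace magic_star F t n} :=
  (tip F t n (-1) 1 + root_line F t n (-1) 3 + tip F t n (-1) (-1)
   + root_line F t n (-1) (-3))%VS.

(* Since directv looks through definitions at the syntactic shape of its
   argument, it is only used here on sums of variables: the members of s are
   taken as wholes, whether or not they are themselves defined as sums. *)
Definition is_direct_sum (F : fieldType) (L : vectType F) (V : {vspace L})
    (s : seq {vspace L}) : Prop :=
  V = (\sum_(i < size s) nth 0%VS s i)%VS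
  /\ directv (\sum_(i < size s) nth 0%VS s i)%VS.

Definition subalgebra (F : fieldType) (L : vectType F) (mu : L -> L -> L)
    (A : {vspace L}) : Prop :=
  forall u v : L, u \in A -> v \in A -> mu u v \in A.

Definition five_grading (F : fieldType) (L : vectType F) (mu : L -> L -> L)
    (g : int -> {vspace L}) : Prop :=
  [/\ forall i : int, 2 < `|i| -> g i = 0%VS,
      is_direct_sum fullv [seq g i | i <- [:: -2; -1; 0; 1; 2]]
    & forall (i j : int) (u v : L),
        u \in g i -> v \in g j -> mu u v \in g (i + j)].

Definition magic_grading (F : fieldType) (t : magic_type) (n : nat) (i : int) :
    {vspace magic_star F t n} :=
  if i == 0 then (g_III F t n + C_part F t n)%VS
  else if i == 1 then Fplus F t n
  else if i == -1 then Fminus F t n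
  else if i == 2 then root_line F t n 2 0
  else if i == -2 then root_line F t n (-2) 0
  else 0%VS.

(* Main.v *)
Require Import Defs.
From mathcomp Require Import all_boot all_order all_algebra.
From mathcomp Require Import zify ring.

(* The grading is the eigenspace decomposition for k_1 - k_2: give h_i degree 0
   and x_a the degree (a, k_1 - k_2), which is additive in a, so the bracket
   respects it whatever the signs epsilon are. A case analysis of the roots shows
   that x_a of degree 0, +-1, +-2 lies in the announced summand, and directness
   for the x_a is disjointness of supports. The real content is in the span of the
   h_i. It must be the span of the h_a with a a center root, h_{k_1+k_2-2k_3} and
   h_{k_1-k_2}: the sum is direct because the last two vectors are orthogonal to
   each other and to all center roots, and it is everything because the center
   roots span the orthogonal complement of those two (this uses n >= 1).
   As h is defined through integral simple-root coordinates, both arguments need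
   the simple roots to be free and all roots to have integral coordinates, which
   is read off an explicit dual basis. *)

Set Implicit Arguments.
Unset Strict Implicit.
Unset Printing Implicit Defensive.

Import Order.TTheory GRing.Theory Num.Theory.
Local Open Scope ring_scope.

(** * Rational numbers inside a field of characteristic 0 *)

Section RatrChar0.
Variable F : fieldType.
Hypothesis char0 : [pchar F] =i pred0.

Lemma pchar0_natr_eq0 k : (k%:R == 0 :> F) = (k == 0)%N.
Proof. exact: (pcharf0P F).1 char0 k. Qed.

Lemma pchar0_intr_eq0 (z : int) : (z%:~R == 0 :> F) = (z == 0).
Proof.
case: z => k; first by rewrite -pmulrn pchar0_natr_eq0.
by rewrite NegzE mulrNz oppr_eq0 -pmulrn pchar0_natr_eq0.
Qed.

(** [ratr] is computed from the reduced fraction; since nonzero integers stay nonzero in [F], any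
    other fraction representing [x] gives the same value. Sums and products can then be compared
    over the common denominator [denq x * denq y]. *)
Lemma pchar0_ratr_frac (x : rat) (z d : int) :
  x * d%:~R = z%:~R -> d != 0 -> ratr x = z%:~R / d%:~R :> F.
Proof.
move=> e d0.
have dF0: d%:~R != 0 :> F by rewrite pchar0_intr_eq0.
have nF0: (denq x)%:~R != 0 :> F by rewrite pchar0_intr_eq0 denq_eq0.
have E : numq x * d = z * denq x.
  apply/eqP; rewrite -(eqr_int rat) !intrM -e numqE; apply/eqP.
  by rewrite mulrAC.
by apply/eqP; rewrite /ratr eqr_div // -!intrM E.
Qed.

Lemma pchar0_ratrD : {morph (@ratr F) : x y / x + y}.
Proof.
move=> x y; pose d := denq x * denq y.
have d0 : d != 0 by rewrite mulf_neq0 ?denq_eq0.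
rewrite (@pchar0_ratr_frac _ (numq x * denq y + numq y * denq x) d) //; last first.
  by rewrite /d intrD !intrM !numqE; ring.
rewrite /ratr addf_div ?pchar0_intr_eq0 ?denq_eq0 //.
by rewrite intrD !intrM.
Qed.

Lemma pchar0_ratrM : {morph (@ratr F) : x y / x * y}.
Proof.
move=> x y; pose d := denq x * denq y.
have d0 : d != 0 by rewrite mulf_neq0 ?denq_eq0.
rewrite (@pchar0_ratr_frac _ (numq x * numq y) d) //; last first.
  by rewrite /d !intrM !numqE; ring.
by rewrite /ratr mulf_div !intrM.
Qed.

Lemma pchar0_ratr_sum (I : finType) (f : I -> rat) :
  ratr (\sum_i f i) = \sum_i ratr (f i) :> F.
Proof. exact: (big_morph _ pchar0_ratrD (ratr_int F 0)). Qed.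

Lemma pchar0_ratr_eq0 (x : rat) : (ratr x == 0 :> F) = (x == 0).
Proof.
rewrite /ratr mulf_eq0 invr_eq0 !pchar0_intr_eq0 denq_eq0 orbF.
by rewrite numq_eq0.
Qed.

End RatrChar0.

(** * Direct sums of lists of subspaces, and induction on spans *)

Section DirectSums.
Variables (F : fieldType) (L : vectType F).
Implicit Types (U V W : {vspace L}) (s : seq {vspace L}).

Lemma is_direct_sum_nil : is_direct_sum (0%VS : {vspace L}) [::].
Proof.
split; first by rewrite big_ord0.
by apply/directv_sum_independent => us _ _ [].
Qed.

(** Reduces directness of a list to one trivial intersection at a time: in a vanishing sum, the head
    component is minus the sum of the others, hence lies in [U] and in [W]. *)
Lemma is_direct_sum_cons U V W s :
  is_direct_sum W s -> V = (U + W)%VS -> (forall u, u \in U -> u \in W -> u = 0) ->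
  is_direct_sum V (U :: s).
Proof.
move=> [eW dW] -> dUW; split.
  rewrite /= big_ord_recl /= eW; congr (_ + _)%VS.
apply/directv_sum_independent => us; rewrite /= => Uus.
rewrite big_ord_recl => us0.
have tailW : \sum_(i < size s) us (lift ord0 i) \in W.
  rewrite eW; apply: memv_sumr => i _; exact: (Uus (lift ord0 i)).
have h0 : us ord0 = 0.
  apply: dUW; first exact: (Uus ord0).
  move/eqP: us0; rewrite addr_eq0 => /eqP ->; by rewrite memvN.
move: us0; rewrite h0 add0r => us0.
move=> i _; case: (unliftP ord0 i) => [j|] -> //.
exact: (directv_sum_independent dW (fun j => us (lift ord0 j))
          (fun j _ => Uus (lift ord0 j) isT)).
Qed.

End DirectSums.

Lemma span_ind (F : fieldType) (L : vectType F) (K : L -> Prop) (X : seq L) :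
  K 0 -> (forall a u v, K u -> K v -> K (a *: u + v)) -> {in X, forall x, K x} ->
  {in <<X>>%VS, forall u, K u}.
Proof.
move=> K0 KD KX u /(coord_span (X := in_tuple X)) ->.
elim/big_ind: _ => // [x y Kx Ky|i _].
  by rewrite -[x]scale1r; apply: KD.
rewrite -[_ *: _]addr0; apply: KD => //; apply: KX.
by rewrite mem_nth.
Qed.

(** * Coordinate subspaces of the algebra *)

Section Support.
Variables (F : fieldType) (t : magic_type) (n : nat).
Local Notation I := (basis_index t n).
Local Notation L := (magic_star F t n).

Definition basis_vector (p : I) : L := [ffun q : I => (q == p)%:R : F^o].

Definition supported (D : pred I) : {vspace L} :=
  <<[seq basis_vector p | p <- enum D]>>%VS.

Lemma basis_decomposition (u : L) : u = \sum_p u p *: basis_vector p.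
Proof.
apply/ffunP => q; rewrite sum_ffunE (bigD1 q) //= big1 => [|p pq].
  by rewrite !ffunE eqxx addr0 /GRing.scale /= mulr1.
by rewrite !ffunE eq_sym (negPf pq) /GRing.scale /= mulr0.
Qed.

(** Turns membership in a span of basis vectors into vanishing of coordinates, so that inclusions
    and intersections become statements about predicates on the basis. *)
Lemma memv_supported (D : pred I) (u : L) :
  reflect (forall p, ~~ D p -> u p = 0) (u \in supported D).
Proof.
apply: (iffP idP) => [|uD].
  move=> uD p Dp.
  rewrite (coord_span (X := in_tuple _) uD) sum_ffunE big1 // => i _.
  rewrite ffunE.
  have /mapP[q] : (in_tuple [seq basis_vector p | p <- enum D])`_i
      \in [seq basis_vector p | p <- enum D] by exact: mem_nth.
  rewrite mem_enum => Dq ->; rewrite ffunE.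
  case: eqP => [epq|_]; last by rewrite /GRing.scale /= mulr0.
  by move: Dp; rewrite epq (Dq : D q).
rewrite [u]basis_decomposition; apply: memv_suml => p _.
case: (boolP (D p)) => Dp; last by rewrite uD // scale0r mem0v.
by apply: memvZ; apply: memv_span; apply: map_f; rewrite mem_enum.
Qed.

End Support.

(** * Roots and their star types *)

Section Coordinates.
Variable n : nat.
Local Notation N := (dimN n).
Local Notation V := 'rV[rat]_N.
Implicit Types u v w : V.

Lemma dotE u v : dot u v = \sum_l u 0 l * v 0 l.
Proof. by rewrite /dot mxE; apply: eq_bigr => l _; rewrite mxE. Qed.

Lemma dotC u v : dot u v = dot v u.
Proof. by rewrite !dotE; apply: eq_bigr => l _; rewrite mulrC. Qed.

Lemma dotDl u v w : dot (u + v) w = dot u w + dot v w.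
Proof. by rewrite /dot mulmxDl mxE. Qed.

Lemma dotZl a u w : dot (a *: u) w = a * dot u w.
Proof. by rewrite /dot -scalemxAl mxE. Qed.

Lemma dotNl u w : dot (- u) w = - dot u w.
Proof. by rewrite -scaleN1r dotZl mulN1r. Qed.

Lemma dotDr w u v : dot w (u + v) = dot w u + dot w v.
Proof. by rewrite ![dot w _]dotC dotDl. Qed.

Lemma dotZr a w u : dot w (a *: u) = a * dot w u.
Proof. by rewrite ![dot w _]dotC dotZl. Qed.

Lemma dotNr w u : dot w (- u) = - dot w u.
Proof. by rewrite ![dot w _]dotC dotNl. Qed.

Definition dot_linearE := (dotDl, dotDr, dotNl, dotNr, dotZl, dotZr).

Lemma dot_suml (J : Type) (r : seq J) (P : pred J) (f : J -> V) w :
  dot (\sum_(i <- r | P i) f i) w = \sum_(i <- r | P i) dot (f i) w.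
Proof.
apply: (big_morph (fun x => dot x w)) => [x y|]; first exact: dotDl.
by rewrite -(scale0r 0) dotZl mul0r.
Qed.

Lemma dot_kvec_ord v (l : 'I_N) : dot v (kvec n l.+1) = v 0 l.
Proof.
rewrite dotE (bigD1 l) //= big1 => [|j jl].
  by rewrite mxE eqxx mulr1 addr0.
by rewrite mxE eqSS (negPf (jl : val j != val l)) mulr0.
Qed.

Lemma dot_kvec i j :
  dot (kvec n i) (kvec n j) = [&& i == j, 0 < j & j <= N]%N%:R.
Proof.
case: j => [|j].
  rewrite andbF dotE big1 // => l _; by rewrite !mxE mulr0.
case: (ltnP j N) => jN; last first.
  rewrite !andbF dotE big1 // => l _; rewrite !mxE.
  have -> : (l.+1 == j.+1) = false by apply/negbTE; have := ltn_ord l; lia.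
  by rewrite mulr0.
by rewrite -[j]/(val (Ordinal jN)) dot_kvec_ord mxE /= andbT eq_sym.
Qed.

Lemma kvec_decomposition v : v = \sum_(l < N) v 0 l *: kvec n l.+1.
Proof.
apply/rowP => j; rewrite summxE (bigD1 j) //= big1 => [|l lj].
  by rewrite !mxE eqxx mulr1 addr0.
by rewrite !mxE eqSS eq_sym (negPf (lj : val l != val j)) mulr0.
Qed.

Lemma dimN_gt3 : (3 < N)%N. Proof. by rewrite /dimN; lia. Qed.

Lemma has_typeE (r s : int) v :
  has_type r s v =
    (dot v (kvec n 1) - dot v (kvec n 2) == r%:~R) &&
    (dot v (kvec n 1) + dot v (kvec n 2) - 2 * dot v (kvec n 3) == s%:~R).
Proof. by rewrite /has_type !dot_linearE. Qed.

Lemma dot_spinor (P : {set 'I_N}) (l : 'I_N) :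
  dot (spinor P) (kvec n l.+1) = if l \in P then 2^-1 else - 2^-1.
Proof.
rewrite dotZl dot_suml (bigD1 l) //= big1 => [|j jl].
  rewrite dotZl dot_kvec eqxx ltn_ord addr0 mulr1.
  by case: ifP; rewrite ?mulr1 ?mulrN1.
rewrite dotZl dot_kvec eqSS (negPf (jl : val j != val l)) mulr0 //.
Qed.

End Coordinates.

Section Roots.
Variables (t : magic_type) (n : nat).
Local Notation N := (dimN n).
Local Notation R := (ms_rank t n).
Local Notation V := 'rV[rat]_N.
Implicit Types u v w : V.

Definition unit_sign (s : rat) := (s == 1) || (s == -1).

Lemma mem_roots_D m v :
  reflect (exists s1 s2 i j, [/\ unit_sign s1, unit_sign s2, (0 < i < j)%N,
            (j <= m)%N & v = s1 *: kvec n i + s2 *: kvec n j])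
          (v \in roots_D n m).
Proof.
apply: (iffP allpairsP) => [[[[s1 s2] [i j]] /= [sg ij ->]]|].
  move: ij; rewrite mem_filter /= => /andP[lij /allpairsP[[i' j'] /= [hi hj [ei ej]]]].
  subst i' j'; move: hi hj; rewrite !mem_iota => hi hj.
  exists s1, s2, i, j; split=> //; [| | lia | lia];
  by move: sg; rewrite !inE !xpair_eqE /unit_sign; do ?case: eqP.
move=> [s1 [s2 [i [j [u1 u2 ij jm ->]]]]]; exists ((s1, s2), (i, j)); split=> //=.
  by case/orP: u1 => /eqP ->; case/orP: u2 => /eqP ->; rewrite !inE.
rewrite mem_filter /=; apply/andP; split; first lia.
by apply/allpairsP; exists (i, j); rewrite !mem_iota /=; split=> //; lia.
Qed.

(** All three root systems sit inside the one of type [e8], and many arguments use only this common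
    shape. *)
Lemma Phi_cases v : v \in Phi t n ->
  (exists s1 s2 i j, [/\ unit_sign s1, unit_sign s2, (0 < i < j)%N,
            (j <= N)%N & v = s1 *: kvec n i + s2 *: kvec n j])
  \/ exists2 P : {set 'I_N}, ~~ odd #|P| & v = spinor P.
Proof.
have h8 a : a \in roots_e8 n ->
  (exists s1 s2 i j, [/\ unit_sign s1, unit_sign s2, (0 < i < j)%N,
            (j <= N)%N & a = s1 *: kvec n i + s2 *: kvec n j])
  \/ exists2 P : {set 'I_N}, ~~ odd #|P| & a = spinor P.
  rewrite mem_cat => /orP[/mem_roots_D|/mapP[P]]; first by left.
  by rewrite mem_enum inE => oP ->; right; exists P.
case: t => /=; last exact: h8.
  rewrite mem_cat => /orP[/mem_roots_D|/mapP[P]].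
    by move=> [s1 [s2 [i [j [? ? ? ? ?]]]]]; left; exists s1, s2, i, j; split=> //; lia.
  by rewrite mem_enum inE => /andP[oP _] ->; right; exists P.
by rewrite mem_filter => /andP[_]; apply: h8.
Qed.

(** The bound [j < R] is uniform in the type: [R - 1] is N-3, N-2, N-1 for [e6], [e7], [e8], and for
    [e7] such a root avoids [k_{N-1}] and [k_N]. *)
Lemma mem_Phi_D s1 s2 i j : unit_sign s1 -> unit_sign s2 -> (0 < i < j)%N ->
  (j < R)%N -> s1 *: kvec n i + s2 *: kvec n j \in Phi t n.
Proof.
move=> u1 u2 ij.
have H m : (j <= m)%N -> s1 *: kvec n i + s2 *: kvec n j \in roots_D n m.
  by move=> jm; apply/mem_roots_D; exists s1, s2, i, j; split.
case: t => /= jR.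
- by rewrite mem_cat H //; lia.
- rewrite mem_filter mem_cat H ?andbT; last lia.
  rewrite !dot_linearE !dot_kvec.
  have -> : (i == N - 1)%N = false by lia.
  have -> : (j == N - 1)%N = false by lia.
  have -> : (i == N)%N = false by lia.
  have -> : (j == N)%N = false by lia.
  by rewrite /= !(mulr0, oppr0, addr0).
- by rewrite mem_cat H //; lia.
Qed.

Hypothesis n_gt0 : (0 < n)%N.

Lemma dimN_ge8 : (8 <= N)%N. Proof. by rewrite /dimN; lia. Qed.

Lemma ms_rank_bounds : (5 < R <= N)%N.
Proof. by have := dimN_ge8; case: t => /=; lia. Qed.

(** These equations cut out the rational span of the roots: coordinates N-2, N-1, N agree for [e6],
    coordinates N-1 and N agree for [e7], and nothing is imposed for [e8]. *)
Definition tail_constant v :=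
  forall l l' : 'I_N, (R <= l.+1)%N -> (R <= l'.+1)%N -> v 0 l = v 0 l'.

Lemma mem_Phi_spinor (P : {set 'I_N}) : ~~ odd #|P| ->
  (forall l l' : 'I_N, (R <= l.+1)%N -> (R <= l'.+1)%N -> (l \in P) = (l' \in P)) ->
  spinor P \in Phi t n.
Proof.
move=> oP; have h8 : spinor P \in roots_e8 n.
  by rewrite mem_cat map_f ?orbT // mem_enum inE.
have N8 := dimN_ge8.
case: t => //= tP.
  rewrite mem_cat map_f ?orbT // mem_enum inE oP; apply/forallP => l; apply/forallP => l'.
  by apply/implyP => /andP[hl hl']; rewrite (tP l l') //; lia.
rewrite mem_filter h8 andbT dotDr dotNr.
have h1 : (N - 2 < N)%N by lia.
have h2 : (N - 1 < N)%N by lia.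
have -> : (N - 1 = (Ordinal h1).+1)%N by rewrite /=; lia.
have -> : kvec n N = kvec n (Ordinal h2).+1 by rewrite /=; congr kvec; lia.
rewrite !dot_spinor (tP (Ordinal h1) (Ordinal h2)) ?subrr //=; lia.
Qed.

Lemma Phi_tail_constant v : v \in Phi t n -> tail_constant v.
Proof.
have N8 := dimN_ge8.
rewrite /tail_constant; case: t => /=.
- rewrite mem_cat => /orP[/mem_roots_D[s1 [s2 [i [j [_ _ hi hj ->]]]]]|/mapP[P + ->]] l l' hl hl'.
    rewrite !mxE.
    have -> : (l.+1 == i)%N = false by lia.
    have -> : (l.+1 == j)%N = false by lia.
    have -> : (l'.+1 == i)%N = false by lia.
    by have -> : (l'.+1 == j)%N = false by lia.
  rewrite mem_enum inE => /andP[_ /forallP h].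
  move/forallP/(_ l')/implyP : (h l) => h'.
  rewrite -!dot_kvec_ord !dot_spinor (eqP (h' _)) //; lia.
- rewrite mem_filter dotDr dotNr subr_eq0 => /andP[/eqP h _].
  have h1 : (N - 2 < N)%N by lia.
  have h2 : (N - 1 < N)%N by lia.
  have key : v 0 (Ordinal h1) = v 0 (Ordinal h2).
    rewrite -!dot_kvec_ord.
    have -> : ((Ordinal h1).+1 = N - 1)%N by rewrite /=; lia.
    have -> : kvec n (Ordinal h2).+1 = kvec n N by rewrite /=; congr kvec; lia.
    by [].
  suff H (l : 'I_N) : (N - 1 <= l.+1)%N -> v 0 l = v 0 (Ordinal h1) by move=> l l' /H -> /H ->.
  move=> hl; have [e|e] := eqVneq (nat_of_ord l) (N - 2)%N.
    by congr (v 0 _); apply: val_inj.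
  by rewrite key; congr (v 0 _); apply: val_inj; rewrite /=; have := ltn_ord l; lia.
- move=> _ l l' hl hl'; congr (v 0 _); apply: val_inj => /=.
  have := ltn_ord l; have := ltn_ord l'; lia.
Qed.

End Roots.

Definition star_tips : seq (int * int) :=
  [:: (1, 1); (1, -1); (-1, 1); (-1, -1); (0, 2); (0, -2)].

Definition star_vertices : seq (int * int) :=
  [:: (2, 0); (-2, 0); (-1, 3); (1, -3); (-1, -3); (1, 3)].

Section Types.
Variables (t : magic_type) (n : nat).
Local Notation N := (dimN n).
Local Notation R := (ms_rank t n).
Local Notation V := 'rV[rat]_N.
Implicit Types u v w : V.

Lemma dot_kvec123 k j : (j \in [:: 1; 2; 3])%N ->
  dot (kvec n k) (kvec n j) = (k == j)%:R.
Proof.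
move=> hj; rewrite dot_kvec.
have -> : (0 < j <= N)%N by move: hj (dimN_gt3 n); rewrite !inE; lia.
by rewrite andbT.
Qed.

Lemma star_vertex_type (r s : int) : (r, s) \in star_vertices ->
  has_type r s (star_vertex n r s).
Proof.
rewrite /star_vertices !inE !xpair_eqE has_typeE.
by do ![case/orP] => /andP[/eqP-> /eqP->]; rewrite /star_vertex /= !dot_linearE !dot_kvec123.
Qed.

Hypothesis n_gt0 : (0 < n)%N.

Lemma star_vertex_mem_Phi (r s : int) : (r, s) \in star_vertices ->
  star_vertex n r s \in Phi t n.
Proof.
have /andP[R5 _] := ms_rank_bounds t n_gt0.
have pm i j : (0 < i < j)%N -> (j < R)%N -> kvec n i - kvec n j \in Phi t n.
  by move=> ij jR; have := @mem_Phi_D t n 1 (-1) i j isT isT ij jR; rewrite scale1r scaleN1r.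
have mp i j : (0 < i < j)%N -> (j < R)%N -> - (kvec n i - kvec n j) \in Phi t n.
  move=> ij jR; have := @mem_Phi_D t n (-1) 1 i j isT isT ij jR.
  by rewrite scale1r scaleN1r opprB addrC.
rewrite /star_vertices !inE !xpair_eqE.
do ![case/orP] => /andP[/eqP-> /eqP->]; rewrite /star_vertex /=;
  try (apply: pm => //; lia); try (apply: mp => //; lia).
  (* What remains is the pair of vertices (-1,-3) and (1,3), written with [k_3 - k_1], whose indices
     are in decreasing order. *)
  by rewrite -opprB; apply: mp => //; lia.
by rewrite opprB; apply: pm => //; lia.
Qed.

(** Only the first three coordinates matter. For a spinor they are all +-1/2. A root +-k_i +- k_j is
    in the center or a tip if j > 3 or the signs agree; opposite signs with j <= 3 give exactly the
    six vertices. *)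
Lemma Phi_type v : v \in Phi t n ->
  has (fun rs => has_type rs.1 rs.2 v) ((0, 0) :: star_tips)
  || has (fun rs => v == star_vertex n rs.1 rs.2) star_vertices.
Proof.
move=> /Phi_cases[[s1 [s2 [i [j [u1 u2 ij _ ->]]]]]|[P _ ->]]; last first.
  have h1 : (0 < N)%N by have := dimN_gt3 n; lia.
  have h2 : (1 < N)%N by have := dimN_gt3 n; lia.
  have h3 : (2 < N)%N by have := dimN_gt3 n; lia.
  apply/orP; left; rewrite /= !has_typeE.
  rewrite (dot_spinor P (Ordinal h1)) (dot_spinor P (Ordinal h2)).
  rewrite (dot_spinor P (Ordinal h3)).
  by case: (_ \in P); case: (_ \in P); case: (_ \in P); vm_compute.
have [j4|j3] := ltnP 3 j; last have [js|js] := eqVneq s1 s2.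
- apply/orP; left; rewrite /= !has_typeE !dot_linearE !dot_kvec123 //.
  have -> : (j == 1)%N = false by lia.
  have -> : (j == 2)%N = false by lia.
  have -> : (j == 3)%N = false by lia.
  case: i ij => [|[|[|[|i]]]] //= _;
  by case/orP: u1 => /eqP ->; case/orP: u2 => /eqP ->; vm_compute.
- apply/orP; left; rewrite /= !has_typeE !dot_linearE !dot_kvec123 // -js.
  case: i ij => [|[|[|[|i]]]]; case: j j3 => [|[|[|[|j]]]] //= _ _;
  by case/orP: u1 => /eqP ->; vm_compute.
- apply/orP; right.
  have [[e1 e2]|[e1 e2]] : (s1 = 1 /\ s2 = -1) \/ (s1 = -1 /\ s2 = 1).
    by case/orP: u1 js => /eqP ->; case/orP: u2 => /eqP ->; rewrite ?eqxx //; auto.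
  all: rewrite e1 e2 scale1r scaleN1r /= /star_vertex /= !opprB.
  all: case: i ij => [|[|[|[|i]]]]; case: j j3 => [|[|[|[|j]]]] //= _ _.
  all: by rewrite ?[- kvec n _ + _]addrC eqxx ?orbT.
Qed.

End Types.

(** * Simple-root coordinates *)

Section Lattice.
Variables (t : magic_type) (n : nat).
Local Notation N := (dimN n).
Local Notation R := (ms_rank t n).
Local Notation V := 'rV[rat]_N.
Implicit Types u v w : V.

Definition partial_sum (i : nat) v : rat := \sum_(l < N | (l < i)%N) v 0 l.

Definition last_coord v : rat := dot v (kvec n N).

Definition centered_sum (i : nat) v : rat := partial_sum i v - i%:R * last_coord v.

(* Reading off the simple-root coordinates: with b_l = v_l - v_N and m = R - 1,
   the coordinates are the partial sums of the b_l, except that the two spinor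
   nodes of the D_m diagram share b_1 + ... + b_m, and that alpha_R is the only
   simple root with a k_N component. *)
Definition dual_simple (i : nat) v : rat :=
  if i == R then - 2 * last_coord v
  else if i == (R - 1)%N then centered_sum (R - 1) v / 2
  else if i == (R - 2)%N then
    centered_sum (R - 1) v / 2 - (dot v (kvec n (R - 1)) - last_coord v)
  else centered_sum i v.

Lemma partial_sum_linear i a u v :
  partial_sum i (a *: u + v) = a * partial_sum i u + partial_sum i v.
Proof.
rewrite /partial_sum mulr_sumr -big_split /=; apply: eq_bigr => l _.
by rewrite !mxE.
Qed.

Lemma last_coord_linear a u v :
  last_coord (a *: u + v) = a * last_coord u + last_coord v.
Proof. by rewrite /last_coord !dot_linearE. Qed.

Lemma centered_sum_linear i a u v :
  centered_sum i (a *: u + v) = a * centered_sum i u + centered_sum i v.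
Proof.
by rewrite /centered_sum partial_sum_linear last_coord_linear; ring.
Qed.

Lemma dual_simple_linear i a u v :
  dual_simple i (a *: u + v) = a * dual_simple i u + dual_simple i v.
Proof.
rewrite /dual_simple !centered_sum_linear last_coord_linear !dot_linearE.
by do ?case: ifP => _; ring.
Qed.

Lemma partial_sum_kvec i j : partial_sum i (kvec n j) = [&& 0 < j, j <= i & j <= N]%N%:R.
Proof.
rewrite /partial_sum; case: j => [|j].
  by rewrite big1 // => l _; rewrite mxE.
case: (ltnP j N) => jN; last first.
  rewrite !andbF big1 // => l _; rewrite mxE.
  by have -> : (l.+1 == j.+1) = false by apply/negbTE; have := ltn_ord l; lia.
rewrite andbT /=; case: (ltnP j i) => ji.
  rewrite (bigD1 (Ordinal jN)) //= big1 => [|l /andP[_ lj]]; rewrite mxE ?eqxx ?addr0 //.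
  by rewrite eqSS (negPf (lj : val l != val (Ordinal jN))).
rewrite big1 // => l li; rewrite mxE.
by have -> : (l.+1 == j.+1) = false by apply/negbTE; lia.
Qed.

Lemma kvec_sum : \sum_(j < N) kvec n j.+1 = const_mx 1.
Proof.
rewrite [RHS]kvec_decomposition; apply: eq_bigr => l _; by rewrite mxE scale1r.
Qed.

Lemma partial_sum_ones i : (i <= N)%N -> partial_sum i (const_mx 1) = i%:R.
Proof.
move=> iN; rewrite /partial_sum (eq_bigr (fun _ => 1)) => [|l _]; last by rewrite mxE.
by rewrite -(big_ord_widen N (fun _ => 1) iN) sumr_const card_ord.
Qed.

Hypothesis n_gt0 : (0 < n)%N.

(** Each of the three shapes of simple root is handled by computing its [k_N] coordinate, its
    partial sums and its [k_{R-1}] coordinate. *)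
Lemma dual_simple_alpha i j : (0 < i <= R)%N -> (0 < j <= R)%N ->
  dual_simple i (alpha t n j) = (i == j)%:R.
Proof.
move=> hi hj; have /andP[R5 RN] := ms_rank_bounds t n_gt0.
rewrite /alpha; case: (leqP j (R - 2)) => jR.
- have lc : last_coord (kvec n j - kvec n j.+1) = 0.
    rewrite /last_coord !dot_linearE !dot_kvec.
    have -> : (j == N) = false by lia.
    by have -> : (j.+1 == N) = false by lia.
  have ps k : partial_sum k (kvec n j - kvec n j.+1) = (k == j)%:R.
    rewrite addrC -scaleN1r partial_sum_linear !partial_sum_kvec.
    have -> : (j <= N)%N = true by lia.
    have -> : (j < N)%N = true by lia.
    have -> : (0 < j)%N = true by lia.
    by rewrite !andbT /=; case: (ltngtP k j) => _ //=; ring.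
  have dk : dot (kvec n j - kvec n j.+1) (kvec n (R - 1)) = - (j == R - 2)%N%:R.
    rewrite !dot_linearE !dot_kvec.
    have -> : (j == R - 1)%N = false by lia.
    have -> : (j.+1 == R - 1)%N = (j == R - 2)%N by lia.
    have -> : (0 < R - 1 <= N)%N by lia.
    by rewrite !andbT /= sub0r.
  rewrite /dual_simple /centered_sum lc ps dk.
  have -> : (R - 1 == j)%N = false by lia.
  case: eqP => e1; last case: eqP => e2; last case: eqP => e3; last by rewrite mulr0 subr0.
  + by have -> : (i == j)%N = false by lia.
  + have -> : (i == j)%N = false by lia.
    by rewrite mulr0 subr0 mul0r.
  + by rewrite e3 eq_sym mulr0 subr0 mul0r sub0r subr0 opprK.
- case: eqP => jR1.
    (* For [alpha_{R-1}] the total is 2: halving gives 1 at [R - 1], and at [R - 2] the [k_{R-1}]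
       coordinate cancels it. *)
    have lc : last_coord (kvec n (R - 2) + kvec n (R - 1)) = 0.
      rewrite /last_coord !dot_linearE !dot_kvec.
      have -> : (R - 2 == N)%N = false by lia.
      by have -> : (R - 1 == N)%N = false by lia.
    have ps k : partial_sum k (kvec n (R - 2) + kvec n (R - 1))
        = (R - 2 <= k)%N%:R + (R - 1 <= k)%N%:R.
      rewrite -[kvec n (R - 2)]scale1r partial_sum_linear !partial_sum_kvec.
      have -> : (R - 2 <= N)%N = true by lia.
      have -> : (R - 1 <= N)%N = true by lia.
      have -> : (0 < R - 2)%N = true by lia.
      have -> : (0 < R - 1)%N = true by lia.
      by rewrite !andbT /= mul1r.
    have dk : dot (kvec n (R - 2) + kvec n (R - 1)) (kvec n (R - 1)) = 1.
      rewrite !dot_linearE !dot_kvec eqxx.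
      have -> : (R - 2 == R - 1)%N = false by lia.
      have -> : (0 < R - 1 <= N)%N by lia.
      by rewrite add0r.
    rewrite /dual_simple /centered_sum lc !ps dk leqnn.
    have -> : (R - 2 <= R - 1)%N by lia.
    case: eqP => e1; last case: eqP => e2; last case: eqP => e3.
    + by have -> : (i == j)%N = false by lia.
    + have -> : (i == j)%N by lia.
      by rewrite mulr0 subr0.
    + have -> : (i == j)%N = false by lia.
      by rewrite mulr0 subr0.
    + have -> : (R - 2 <= i)%N = false by lia.
      have -> : (R - 1 <= i)%N = false by lia.
      have -> : (i == j)%N = false by lia.
      by rewrite mulr0 subr0.
  (* [alpha_R] is constantly -1/2, so every difference v_l - v_N vanishes and only
     [- 2 * last_coord] survives. *)
  have -> : j = R by lia.
  rewrite kvec_sum -scaleNr -[_ *: const_mx 1]addr0.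
  have lc : last_coord (- 2^-1 *: const_mx 1 + 0) = - 2^-1.
    have h : (N - 1 < N)%N by lia.
    rewrite /last_coord.
    have -> : kvec n N = kvec n (Ordinal h).+1 by rewrite /=; congr kvec; lia.
    by rewrite dot_kvec_ord !mxE mulr1 addr0.
  have ps k : (k <= N)%N -> partial_sum k (- 2^-1 *: const_mx 1 + 0) = - 2^-1 * k%:R.
    move=> kN; rewrite addr0 -[_ *: _]addr0 partial_sum_linear partial_sum_ones //.
    by rewrite /partial_sum big1 ?addr0 // => l _; rewrite mxE.
  have dk : dot (- 2^-1 *: const_mx 1 + 0) (kvec n (R - 1)) = - 2^-1.
    have h : (R - 2 < N)%N by lia.
    have -> : (R - 1 = (Ordinal h).+1)%N by rewrite /=; lia.
    by rewrite dot_kvec_ord !mxE mulr1 addr0.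
  rewrite /dual_simple /centered_sum lc dk !ps; [|lia|lia].
  case: eqP => _ /=; first by [].
  by do ?case: eqP => _; ring.
Qed.

Lemma simple_roots_nth (i : 'I_R) : (simple_roots t n)`_i = alpha t n i.+1.
Proof. by rewrite -tnth_nth tnth_mktuple. Qed.

Lemma dual_simple_sum i (c : 'I_R -> rat) :
  dual_simple i (\sum_j c j *: (simple_roots t n)`_j)
    = \sum_j c j * dual_simple i (alpha t n j.+1).
Proof.
have d0 : dual_simple i 0 = 0.
  by have := dual_simple_linear i (-1) 0 0; rewrite scaler0 addr0 mulN1r addNr.
rewrite (big_morph (dual_simple i) (op1 := +%R) (id1 := 0)) // => [|x y].
  by apply: eq_bigr => j _; rewrite simple_roots_nth -[_ *: _]addr0 dual_simple_linear
    d0 addr0.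
by rewrite -[x]scale1r dual_simple_linear mul1r scale1r.
Qed.

Lemma dual_simple_coord (i : 'I_R) (c : 'I_R -> rat) :
  dual_simple i.+1 (\sum_j c j *: (simple_roots t n)`_j) = c i.
Proof.
rewrite dual_simple_sum (bigD1 i) //= big1 => [|j ji].
  by rewrite dual_simple_alpha ?ltn_ord // eqxx mulr1 addr0.
rewrite dual_simple_alpha ?ltn_ord // eqSS eq_sym (negPf (ji : val j != val i)).
by rewrite mulr0.
Qed.

Lemma simple_roots_free : free (simple_roots t n).
Proof.
apply/freeP => c c0 i; rewrite -(dual_simple_coord i c) c0.
have := dual_simple_linear i.+1 (-1) 0 0; rewrite scaler0 addr0 => ->.
by rewrite mulN1r addNr.
Qed.

Lemma coord_simple_roots (i : 'I_R) v : v \in <<simple_roots t n>>%VS ->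
  coord (simple_roots t n) i v = dual_simple i.+1 v.
Proof. by move=> /coord_span {2}->; rewrite dual_simple_coord. Qed.

Lemma mem_span_alpha i : (0 < i <= R)%N -> alpha t n i \in <<simple_roots t n>>%VS.
Proof.
move=> iR; have h : (i.-1 < R)%N by lia.
have -> : i = (Ordinal h).+1 by rewrite /=; lia.
by rewrite -simple_roots_nth memv_span // mem_nth // size_tuple.
Qed.

(** The two spinor nodes of the D diagram yield [k_{R-1}]; the chain k_i - k_{i+1} then gives the
    others by descending induction. *)
Lemma mem_span_kvec i : (0 < i < R)%N -> kvec n i \in <<simple_roots t n>>%VS.
Proof.
have /andP[R5 RN] := ms_rank_bounds t n_gt0.
have top : kvec n (R - 1) \in <<simple_roots t n>>%VS.
  have h1 := @mem_span_alpha (R - 1); have h2 := @mem_span_alpha (R - 2).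
  have -> : kvec n (R - 1) = 2^-1 *: (alpha t n (R - 1) - alpha t n (R - 2)).
    rewrite /alpha leqnn eqxx.
    have -> : (R - 1 <= R - 2)%N = false by lia.
    have -> : ((R - 2).+1 = R - 1)%N by lia.
    by apply/rowP => l; rewrite !mxE; field.
  by apply/memvZ/memvB; [apply: h1 | apply: h2]; lia.
move=> iR; have -> : (i = R - 1 - (R - 1 - i))%N by lia.
elim: (R - 1 - i)%N => [|d IH]; first by rewrite subn0.
(* The induction is on the distance to [R - 1] and is unbounded, so truncated subtraction reaches
   index 0, where [kvec] is 0 by convention. *)
have [dR|dR] := leqP (R - 1) d.
  by have -> : (R - 1 - d.+1 = R - 1 - d)%N by lia.
have [dR2|dR2] := leqP (R - 1) d.+1.
  have -> : (R - 1 - d.+1 = 0)%N by lia.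
  have -> : kvec n 0 = 0 by apply/rowP => l; rewrite !mxE.
  exact: mem0v.
have := @mem_span_alpha (R - 1 - d.+1); rewrite /alpha.
have -> : (R - 1 - d.+1 <= R - 2)%N by lia.
have -> : ((R - 1 - d.+1).+1 = R - 1 - d)%N by lia.
move=> h; rewrite -[kvec n _](subrK (kvec n (R - 1 - d))) memvD //.
by apply: h; lia.
Qed.

(** Subtracting the common tail value times the all-ones vector, which is -2 [alpha_R], leaves a
    combination of k_1, ..., k_{R-1}. *)
Lemma mem_span_simple_roots v : tail_constant t v -> v \in <<simple_roots t n>>%VS.
Proof.
move=> tv; have /andP[R5 RN] := ms_rank_bounds t n_gt0.
have hN : (N - 1 < N)%N by lia.
pose c := v 0 (Ordinal hN).
have onesS : const_mx 1 \in <<simple_roots t n>>%VS.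
  have := @mem_span_alpha R; rewrite /alpha.
  have -> : (R <= R - 2)%N = false by lia.
  have -> : (R == R - 1)%N = false by lia.
  rewrite kvec_sum -scaleNr => h.
  have -> : const_mx 1 = -2 *: (- 2^-1 *: const_mx 1) :> V.
    by rewrite scalerA; apply/rowP => l; rewrite !mxE.
  by apply: memvZ; apply: h; lia.
rewrite -[v](subrK (c *: const_mx 1)) memvD ?memvZ //.
rewrite [_ - _]kvec_decomposition; apply: memv_suml => l _.
have [lR|lR] := leqP R l.+1.
  by rewrite !mxE (tv l (Ordinal hN)) //= ?mulr1 ?subrr ?scale0r ?mem0v //; lia.
by apply: memvZ; apply: mem_span_kvec; lia.
Qed.

End Lattice.

(** * Integrality of the simple-root coordinates *)

Section Integrality.
Variables (t : magic_type) (n : nat).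
Local Notation N := (dimN n).
Local Notation R := (ms_rank t n).
Local Notation V := 'rV[rat]_N.
Implicit Types u v w : V.

(* Membership in the lattice spanned by the simple roots: these conditions say
   that v is in their rational span and that every dual_simple is integral on v. *)
Definition root_lattice v : Prop :=
  [/\ tail_constant t v, forall l, v 0 l - last_coord v \is a Num.int,
      2 * last_coord v \is a Num.int & centered_sum N v / 2 \is a Num.int].

Lemma last_coord_entry : exists2 l : 'I_N, l.+1 = N & forall v, last_coord v = v 0 l.
Proof.
have h : (N - 1 < N)%N by have := dimN_gt3 n; lia.
exists (Ordinal h) => [/=|v]; first lia.
by rewrite -dot_kvec_ord /last_coord; congr (dot v (kvec n _)); rewrite /=; lia.
Qed.

Lemma root_latticeD u v : root_lattice u -> root_lattice v -> root_lattice (u + v).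
Proof.
move=> [u1 u2 u3 u4] [v1 v2 v3 v4].
rewrite -[u]scale1r; split=> [l l' hl hl'|l||].
- by rewrite !mxE (u1 l l') // (v1 l l').
- rewrite last_coord_linear !mxE !mul1r opprD addrACA; exact: rpredD.
- by rewrite last_coord_linear mul1r mulrDr rpredD.
- by rewrite centered_sum_linear mul1r mulrDl rpredD.
Qed.

Lemma centered_sumE i v : (i <= N)%N ->
  centered_sum i v = \sum_(l < N | (l < i)%N) (v 0 l - last_coord v).
Proof.
move=> iN; rewrite /centered_sum /partial_sum sumrB; congr (_ - _).
rewrite -(big_ord_widen N (fun _ => last_coord v) iN) sumr_const card_ord.
by rewrite mulr_natl.
Qed.

Hypothesis n_gt0 : (0 < n)%N.

(** The terms v_l - v_N with l >= R are zero. The full sum is the one whose parity is easy to read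
    off a root. *)
Lemma centered_sum_tail v : tail_constant t v -> centered_sum (R - 1) v = centered_sum N v.
Proof.
move=> tv; have /andP[R5 RN] := ms_rank_bounds t n_gt0.
rewrite !centered_sumE //; last lia.
rewrite [RHS](bigID (fun l : 'I_N => (l < R - 1)%N)) /= [X in _ + X]big1 ?addr0.
  by apply: eq_bigl => l; rewrite ltn_ord.
move=> l /andP[_ lR]; have [l' hl' ->] := last_coord_entry.
by rewrite (tv l l') ?subrr //; lia.
Qed.

Lemma dual_simple_int i v : (i <= R)%N -> root_lattice v ->
  dual_simple t i v \is a Num.int.
Proof.
move=> iR [v1 v2 v3 v4]; have /andP[R5 RN] := ms_rank_bounds t n_gt0.
rewrite /dual_simple mulNr !centered_sum_tail //.
case: eqP => _; first by rewrite rpredN.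
case: eqP => // _; case: eqP => _; last first.
  by rewrite centered_sumE ?rpred_sum //; lia.
rewrite rpredB //; have h : (R - 2 < N)%N by lia.
have -> : (R - 1 = (Ordinal h).+1)%N by rewrite /=; lia.
by rewrite dot_kvec_ord.
Qed.

(** On the lattice [numq] loses nothing, so [lcoord] may be replaced there by a linear
    coordinate. *)
Lemma lcoordK v (i : 'I_R) : root_lattice v ->
  (lcoord v i)%:~R = coord (simple_roots t n) i v.
Proof.
move=> vL; rewrite /lcoord numqK // coord_simple_roots //.
  by apply: dual_simple_int.
by case: vL => v1 _ _ _; apply: mem_span_simple_roots.
Qed.

Lemma unit_sign_int s : unit_sign s -> s \is a Num.int.
Proof. by case/orP => /eqP ->. Qed.

(** The delicate point is that the coordinate sum minus N v_N is even. As 4 divides N, N v_N is even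
    both for integral v_N and for v_N = +-1/2. The coordinate sum is s1 + s2 in one case and #|P| -
    N/2 in the other, even because #|P| and N/2 are. *)
Lemma Phi_root_lattice v : v \in Phi t n -> root_lattice v.
Proof.
move=> vP; have tv := Phi_tail_constant n_gt0 vP.
suff [h1 h2 h3] : [/\ forall l, v 0 l - last_coord v \is a Num.int,
    2 * last_coord v \is a Num.int & centered_sum N v / 2 \is a Num.int] by [].
have NE : N%:R = 4 * n.+1%:R :> rat by rewrite /dimN natrM.
case: (Phi_cases vP) => [[s1 [s2 [i [j [u1 u2 ij jN ev]]]]]|[P oP ev]].
  have iv l : v 0 l \is a Num.int.
    rewrite ev !mxE; apply: rpredD; apply: rpredM;
      first [exact: unit_sign_int | exact: natr_int].
  have il : last_coord v \is a Num.int.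
    by have [l _ ->] := last_coord_entry.
  split=> [l||]; first exact: rpredB.
    by rewrite rpredM.
  have pv : partial_sum N v = s1 + s2.
    rewrite ev partial_sum_linear -[s2 *: _]addr0 partial_sum_linear !partial_sum_kvec.
    have -> : [&& 0 < i, i <= N & i <= N]%N by apply/and3P; split; lia.
    have -> : [&& 0 < j, j <= N & j <= N]%N by apply/and3P; split; lia.
    by rewrite /= !mulr1 {1}/partial_sum big1 ?addr0 // => l _; rewrite mxE.
  rewrite /centered_sum pv NE.
  have -> : (s1 + s2 - 4 * n.+1%:R * last_coord v) / 2
    = (s1 + s2) / 2 - 2 * n.+1%:R * last_coord v by field.
  apply: rpredB; last by rewrite !rpredM ?natr_int.
  by case/orP: u1 => /eqP ->; case/orP: u2 => /eqP ->.
have vE l : v 0 l = (l \in P)%:R - 2^-1.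
  by rewrite -dot_kvec_ord ev dot_spinor; case: (l \in P).
have [lN hlN lastE] := last_coord_entry.
split=> [l||]; rewrite ?lastE ?vE.
- by case: (l \in P); case: (lN \in P).
- by case: (lN \in P).
rewrite /centered_sum lastE vE.
have -> : partial_sum N v = #|P|%:R - N%:R / 2.
  rewrite /partial_sum (eq_bigl predT) => [|l]; last by rewrite ltn_ord.
  rewrite (eq_bigr _ (fun l _ => vE l)) sumrB sumr_const card_ord.
  rewrite -natr_sum -[2^-1 *+ _]mulr_natl; congr (_%:R - _).
  by rewrite -sum1_card [RHS]big_mkcond; apply: eq_bigr => l _; case: (l \in P).
have [k ->] : exists k, #|P| = (2 * k)%N.
  by exists #|P|./2; have := odd_double_half #|P|; rewrite (negPf oP); lia.
rewrite NE natrM; case: (lN \in P) => /=.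
  have -> : (2 * k%:R - 4 * n.+1%:R / 2 - 4 * n.+1%:R * (1 - 2^-1)) / 2
     = k%:R - 2 * n.+1%:R :> rat by field.
  by rewrite rpredB // ?rpredM // ?natr_int.
have -> : (2 * k%:R - 4 * n.+1%:R / 2 - 4 * n.+1%:R * (0 - 2^-1)) / 2
     = k%:R :> rat by field.
by rewrite natr_int.
Qed.

Lemma kvecB_in_Phi : kvec n 1 - kvec n 2 \in Phi t n.
Proof. exact: (@star_vertex_mem_Phi t n n_gt0 2 0). Qed.

(** This vector is not a root, but it is the sum of the roots k_1 - k_3 and k_2 - k_3. *)
Lemma kvecDB_root_lattice : root_lattice (kvec n 1 + kvec n 2 - 2 *: kvec n 3).
Proof.
have -> : kvec n 1 + kvec n 2 - 2 *: kvec n 3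
   = - (kvec n 3 - kvec n 1) + (kvec n 2 - kvec n 3).
  by apply/rowP => l; rewrite !mxE; ring.
apply: root_latticeD; apply: Phi_root_lattice.
  exact: (@star_vertex_mem_Phi t n n_gt0 1 3).
exact: (@star_vertex_mem_Phi t n n_gt0 (-1) 3).
Qed.

End Integrality.

(** * The span of the h_i *)

Section Cartan.
Variables (F : fieldType) (t : magic_type) (n : nat).
Hypothesis char0 : [pchar F] =i pred0.
Hypothesis n_gt0 : (0 < n)%N.
Local Notation N := (dimN n).
Local Notation R := (ms_rank t n).
Local Notation V := 'rV[rat]_N.
Local Notation L := (magic_star F t n).
Implicit Types w : V.

(* The rational-linear extension of hvec, which is additive only where the simple-root
   coordinates are integral. *)
Definition hlin (v : V) : L :=
  \sum_(i < R) (ratr (coord (simple_roots t n) i v) : F) *: hgen F i.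

Lemma hlin_linear a (u v : V) : hlin (a *: u + v) = ratr a *: hlin u + hlin v.
Proof.
rewrite /hlin scaler_sumr -big_split; apply: eq_bigr => i _ /=.
by rewrite linearP /= (pchar0_ratrD char0) (pchar0_ratrM char0) scalerDl scalerA.
Qed.

Lemma hvecE v : root_lattice t v -> hvec F t v = hlin v.
Proof.
move=> vL; apply: eq_bigr => i _.
by rewrite -(lcoordK n_gt0 i vL) ratr_int.
Qed.

Lemma hlin_alpha (i : 'I_R) : hlin (alpha t n i.+1) = hgen F i.
Proof.
rewrite /hlin (bigD1 i) //= big1 => [|j ji].
  rewrite -simple_roots_nth coord_free ?simple_roots_free // eqxx.
  by rewrite (ratr_nat F 1) scale1r addr0.
rewrite -simple_roots_nth coord_free ?simple_roots_free //.
by rewrite (negPf (_ : i != j)) ?(ratr_nat F 0) ?scale0r // eq_sym.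
Qed.

(* The functional h_v |-> (v, w) on the span of the h_i, extended by 0 to the x_a. *)
Definition pairing w (u : L) : F :=
  \sum_(i < R) u (inl i) * ratr (dot (alpha t n i.+1) w).

Lemma pairing_linear w a (u v : L) :
  pairing w (a *: u + v) = a * pairing w u + pairing w v.
Proof.
rewrite /pairing mulr_sumr -big_split; apply: eq_bigr => i _ /=.
by rewrite !ffunE mulrDl -mulrA.
Qed.

Lemma pairing_hlin w v : tail_constant t v -> pairing w (hlin v) = ratr (dot v w).
Proof.
move=> tv; have hv (i : 'I_R) : hlin v (inl i) = ratr (coord (simple_roots t n) i v).
  rewrite sum_ffunE (bigD1 i) //= big1 => [|j ji].
    by rewrite !ffunE eqxx addr0 /GRing.scale /= mulr1.
  rewrite !ffunE; case: eqP => [[e]|_]; first by rewrite e eqxx in ji.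
  by rewrite /GRing.scale /= mulr0.
rewrite /pairing (eq_bigr _ (fun i _ => congr1 (fun x => x * _) (hv i))).
rewrite [in RHS](coord_span (mem_span_simple_roots n_gt0 tv)) dot_suml.
rewrite (pchar0_ratr_sum char0); apply: eq_bigr => i _.
by rewrite dotZl (pchar0_ratrM char0) simple_roots_nth.
Qed.

Lemma pairing_hvec w v : root_lattice t v -> pairing w (hvec F t v) = ratr (dot v w).
Proof. by move=> vL; rewrite hvecE // pairing_hlin //; case: vL. Qed.

Lemma pairing_xvec w v : pairing w (xvec F t v) = 0.
Proof. by rewrite /pairing big1 // => i _; rewrite ffunE mul0r. Qed.

Lemma pairing0 w : pairing w 0 = 0.
Proof. by rewrite /pairing big1 // => i _; rewrite ffunE mul0r. Qed.

Lemma pairingD w (u v : L) : pairing w (u + v) = pairing w u + pairing w v.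
Proof. by rewrite -[u]scale1r pairing_linear mul1r scale1r. Qed.

Lemma pairingZ w a (u : L) : pairing w (a *: u) = a * pairing w u.
Proof. by rewrite -[_ *: _]addr0 pairing_linear pairing0 addr0. Qed.

(** Meant for w = k_1 - k_2 and w = k_1 + k_2 - 2 k_3, to which roots of type (0,0) are orthogonal
    by definition. *)
Lemma pairing_g_0 w : (forall v, has_type 0 0 v -> dot v w = 0) ->
  {in g_0 F t n, forall u, pairing w u = 0}.
Proof.
move=> w0; apply: span_ind => [|a u v|u].
- exact: pairing0.
- by rewrite pairing_linear => -> ->; rewrite mulr0 addr0.
- rewrite mem_cat => /orP[/mapP[a _ ->]|/mapP[a]]; first exact: pairing_xvec.
  rewrite mem_filter => /andP[/w0 aw aP] ->.
  by rewrite pairing_hvec ?aw ?(ratr_nat F 0) //; apply: Phi_root_lattice.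
Qed.

(** The grade 0 space without its tips (0,2) and (0,-2); it already contains every h_i. *)
Definition cartan_center : {vspace L} :=
  (g_0 F t n + <[hvec F t (kvec n 1 + kvec n 2 - 2 *: kvec n 3)]>
   + <[hvec F t (kvec n 1 - kvec n 2)]>)%VS.

Lemma card_ord_lt (M k : nat) : (k <= M)%N -> #|[set l : 'I_M | (l < k)%N]| = k.
Proof.
move=> kM; rewrite -sum1_card (eq_bigl (fun l : 'I_M => (l < k)%N)) => [|l].
  by rewrite -(big_ord_widen M (fun _ => 1%N) kM) sum1_card card_ord.
by rewrite inE.
Qed.

(* Center roots D_{R-4} together with two spinors give every vector of the
   rational span that is orthogonal to k_1 - k_2 and k_1 + k_2 - 2 k_3. *)
Lemma hgen_in_cartan_center (i : 'I_R) : hgen F i \in cartan_center.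
Proof.
have /andP[R5 RN] := ms_rank_bounds t n_gt0; have N8 := dimN_ge8 n_gt0.
(* [A] is closed under rational combinations, so the goal becomes to generate every simple root from
   vectors known to satisfy [A]. *)
pose A v := hlin v \in cartan_center.
have AL a u v : A u -> A v -> A (a *: u + v).
  by move=> Au Av; rewrite /A hlin_linear memvD ?memvZ.
have A0 : A 0.
  rewrite /A /hlin big1 ?mem0v // => j _.
  by rewrite linear0 (ratr_nat F 0) scale0r.
have AZ a u : A u -> A (a *: u) by move=> Au; rewrite -[_ *: _]addr0; apply: AL.
have AD u v : A u -> A v -> A (u + v).
  by move=> Au Av; rewrite -[u]scale1r; apply: AL.
have AB u v : A u -> A v -> A (u - v).
  by move=> Au Av; apply: AD => //; rewrite -scaleN1r; apply: AZ.
have Aroot a : a \in Phi t n -> has_type 0 0 a -> A a.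
  move=> aP a0; rewrite /A -hvecE; last exact: Phi_root_lattice.
  rewrite /cartan_center -addvA (subvP (addvSl _ _)) //.
  by rewrite memv_span // mem_cat map_f ?orbT // mem_filter a0.
have A12 : A (kvec n 1 - kvec n 2).
  rewrite /A -hvecE; last exact/Phi_root_lattice/kvecB_in_Phi.
  by rewrite (subvP (addvSr _ _)) ?memv_line.
have A123 : A (kvec n 1 + kvec n 2 - 2 *: kvec n 3).
  rewrite /A -hvecE; last exact: kvecDB_root_lattice.
  by rewrite (subvP (addvSl _ _)) // (subvP (addvSr _ _)) ?memv_line.
have Apair j k : (3 < j < k)%N -> (k < R)%N -> A (kvec n j) /\ A (kvec n k).
  move=> jk kR.
  have tp s1 s2 : has_type 0 0 (s1 *: kvec n j + s2 *: kvec n k).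
    rewrite has_typeE !dot_linearE !dot_kvec123 //.
    have -> : (j == 1)%N = false by lia.
    have -> : (j == 2)%N = false by lia.
    have -> : (j == 3)%N = false by lia.
    have -> : (k == 1)%N = false by lia.
    have -> : (k == 2)%N = false by lia.
    have -> : (k == 3)%N = false by lia.
    by rewrite /= !(mulr0, addr0, subr0, oppr0).
  have jk0 : (0 < j < k)%N by lia.
  have Ap : A (1 *: kvec n j + 1 *: kvec n k) by apply: Aroot (tp _ _); apply: mem_Phi_D.
  have Am : A (1 *: kvec n j + (-1) *: kvec n k) by apply: Aroot (tp _ _); apply: mem_Phi_D.
  split.
    have -> : kvec n j
        = 2^-1 *: ((1 *: kvec n j + 1 *: kvec n k) + (1 *: kvec n j + (-1) *: kvec n k)).
      by apply/rowP => l; rewrite !mxE; field.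
    by apply: AZ; apply: AD.
  have -> : kvec n k
      = 2^-1 *: ((1 *: kvec n j + 1 *: kvec n k) - (1 *: kvec n j + (-1) *: kvec n k)).
    by apply/rowP => l; rewrite !mxE; field.
  by apply: AZ; apply: AB.
(* Isolating k_4 takes a second index strictly between 3 and [R]; the bound 5 < R coming from n >= 1
   provides it. *)
have A4 : A (kvec n 4) by case: (Apair 4%N 5%N isT R5).
(* Equal signs on k_1, k_2, k_3 put the spinor in the center, and equal signs beyond k_4 make it a
   root for all three types. *)
have Aspinor (P : {set 'I_N}) : ~~ odd #|P| -> (forall l : 'I_N, (l < 4)%N -> l \in P) ->
    (forall l l' : 'I_N, (3 < l)%N -> (3 < l')%N -> (l \in P) = (l' \in P)) -> A (spinor P).
  move=> oP P3 Pt; apply: Aroot.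
    by apply: mem_Phi_spinor => // l l' hl hl'; apply: Pt; lia.
  have h1 : (0 < N)%N by lia.
  have h2 : (1 < N)%N by lia.
  have h3 : (2 < N)%N by lia.
  rewrite has_typeE (dot_spinor P (Ordinal h1)) (dot_spinor P (Ordinal h2)).
  rewrite (dot_spinor P (Ordinal h3)).
  by rewrite !P3.
have Aones : A (const_mx 1).
  have -> : const_mx 1 = 2 *: spinor setT :> V.
    by apply/rowP => l; rewrite mxE [RHS]mxE -dot_kvec_ord dot_spinor inE.
  apply: AZ; apply: Aspinor => [|l|l l' _ _]; rewrite ?inE //.
  by rewrite cardsT card_ord /dimN oddM.
have A3 : A (kvec n 1 + kvec n 2 + kvec n 3).
  (* Plus signs on k_1, ..., k_4 only: adding half the all-ones vector gives k_1 + k_2 + k_3 + k_4.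
     The fourth sign makes the number of plus signs even. *)
  pose P := [set l : 'I_N | (l < 4)%N].
  have -> : kvec n 1 + kvec n 2 + kvec n 3
      = spinor P + 2^-1 *: const_mx 1 - kvec n 4.
    apply/rowP => l; have := dot_spinor P l; rewrite dot_kvec_ord inE.
    move: (spinor P) => s; rewrite !mxE => ->.
    by case: (nat_of_ord l) => [|[|[|[|k]]]].
  apply: AB => //; apply: AD; last exact: AZ.
  apply: Aspinor => [|l|l l']; rewrite ?inE //.
    by rewrite card_ord_lt //; lia.
  by move=> hl hl'; rewrite ![(_ < 4)%N]ltnNge ?hl ?hl'.
have Ak3 : A (kvec n 3).
  have -> : kvec n 3 = 3^-1 *: ((kvec n 1 + kvec n 2 + kvec n 3)
      - (kvec n 1 + kvec n 2 - 2 *: kvec n 3)).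
    by apply/rowP => l; rewrite !mxE; field.
  by apply: AZ; apply: AB.
have Ak1 : A (kvec n 1).
  have -> : kvec n 1 = 2^-1 *: ((kvec n 1 + kvec n 2 + kvec n 3)
      + (kvec n 1 - kvec n 2) - kvec n 3).
    by apply/rowP => l; rewrite !mxE; field.
  by apply: AZ; apply: AB => //; apply: AD.
have Ak2 : A (kvec n 2).
  rewrite -[kvec n 2](subKr (kvec n 1)); exact: AB.
have Ak j : (0 < j < R)%N -> A (kvec n j).
  move=> hj; have [j4|j4] := ltnP 4 j.
    by have [] : A (kvec n 4) /\ A (kvec n j) by apply: Apair; lia.
  by case: j hj j4 => [|[|[|[|[|j]]]]].
rewrite -hlin_alpha -/(A _) /alpha; case: ifP => h1.
  by apply: AB; apply: Ak; lia.
case: ifP => h2; first by apply: AD; apply: Ak; lia.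
by rewrite kvec_sum -scaleN1r; apply: (AZ _ _ (AZ _ _ Aones)).
Qed.

End Cartan.

(** Sums of subspaces associate to the left, so a summand is found by dropping right-hand terms
    until it is the last one. *)
Ltac solve_subv :=
  rewrite /g_III /Fplus /Fminus;
  repeat first
    [exact: subvv | exact: addvSr | apply: (subv_trans _ (addvSl _ _))].

(** * The grading *)

Section Grading.
Variables (F : fieldType) (t : magic_type) (n : nat).
Hypothesis char0 : [pchar F] =i pred0.
Hypothesis n_gt0 : (0 < n)%N.
Local Notation N := (dimN n).
Local Notation R := (ms_rank t n).
Local Notation V := 'rV[rat]_N.
Local Notation I := (basis_index t n).
Local Notation L := (magic_star F t n).

Definition degree (p : I) : rat :=
  if p is inr a then dot (val a) (kvec n 1 - kvec n 2) else 0.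

Definition has_degree (r : rat) : pred I := fun p => degree p == r.

Definition is_root_of_type (r s : int) : pred I :=
  fun p => if p is inr a then has_type r s (val a) else false.

Definition is_cartan : pred I := fun p => if p is inl _ then true else false.

Lemma basis_vector_inr (a : seq_sub (Phi t n)) :
  basis_vector F (inr a : I) = xvec F t (val a).
Proof. by apply/ffunP => -[i|b]; rewrite !ffunE. Qed.

Lemma mem_supported_basis (D : pred I) (p : I) : D p -> basis_vector F p \in supported F D.
Proof.
move=> Dp; apply/memv_supported => q Dq; rewrite ffunE.
by case: eqP => // e; rewrite e Dp in Dq.
Qed.

Lemma supported_subv (D : pred I) (U : {vspace L}) :
  (forall p, D p -> basis_vector F p \in U) -> (supported F D <= U)%VS.
Proof. by move=> DU; apply/span_subvP => u /mapP[p]; rewrite mem_enum => /DU Up ->. Qed.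

Lemma supported_mono (D D' : pred I) : {subset D <= D'} ->
  (supported F D <= supported F D')%VS.
Proof. by move=> DD'; apply: supported_subv => p /DD'; apply: mem_supported_basis. Qed.

Lemma mem_supported_xvec (D : pred I) (v : V) :
  (forall a : seq_sub (Phi t n), val a = v -> D (inr a)) -> xvec F t v \in supported F D.
Proof.
move=> Dv; apply/memv_supported => -[i|a] Da; rewrite ffunE //.
by case: eqP => // /Dv; rewrite (negPf Da).
Qed.

Lemma mem_supported_hvec (D : pred I) (v : V) :
  (forall i, D (inl i)) -> hvec F t v \in supported F D.
Proof.
by move=> Dh; apply: memv_suml => i _; apply: memvZ; apply: (mem_supported_basis (Dh i)).
Qed.

Lemma has_type_dot (r s : int) (v : V) : has_type r s v ->
  dot v (kvec n 1 - kvec n 2) = r%:~R /\ dot v (kvec n 1 + kvec n 2 - 2 *: kvec n 3) = s%:~R.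
Proof. by case/andP => /eqP ? /eqP ?. Qed.

Lemma has_degree_type r s (v : V) (a : seq_sub (Phi t n)) :
  has_type r s v -> val a = v -> has_degree r%:~R (inr a).
Proof. by move=> /has_type_dot[h _] e; rewrite /has_degree /= e h. Qed.

Lemma tip_supported r s : (tip F t n r s <= supported F (is_root_of_type r s))%VS.
Proof.
apply/span_subvP => u /mapP[a]; rewrite mem_filter => /andP[ar _] ->.
by apply: mem_supported_xvec => b; rewrite /= => ->.
Qed.

Lemma is_root_of_type_degree r s : {subset is_root_of_type r s <= has_degree r%:~R}.
Proof. by case=> // a /has_type_dot[h _]; apply/eqP. Qed.

Lemma tip_degree r s : (tip F t n r s <= supported F (has_degree r%:~R))%VS.
Proof.
exact: subv_trans (tip_supported r s) (supported_mono (@is_root_of_type_degree r s)).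
Qed.

Lemma root_line_degree r s : (r, s) \in star_vertices ->
  (root_line F t n r s <= supported F (has_degree r%:~R))%VS.
Proof.
by move=> rs; rewrite -memvE; apply: mem_supported_xvec => a;
  apply: has_degree_type (star_vertex_type n rs).
Qed.

Lemma line_hvec_supported (D : pred I) (v : V) : (forall i, D (inl i)) ->
  (<[hvec F t v]> <= supported F D)%VS.
Proof. by move=> Dh; rewrite -memvE; apply: mem_supported_hvec. Qed.

Lemma g_0_supported :
  (g_0 F t n <= supported F (predU is_cartan (is_root_of_type 0 0)))%VS.
Proof.
apply/span_subvP => u; rewrite mem_cat => /orP[] /mapP[a].
  rewrite mem_filter => /andP[ar _] ->.
  by apply: mem_supported_xvec => b; rewrite /= => ->.
by move=> _ ->; apply: mem_supported_hvec.
Qed.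

Lemma xvec_tip r s (a : seq_sub (Phi t n)) : has_type r s (val a) ->
  basis_vector F (inr a : I) \in tip F t n r s.
Proof.
move=> ar; rewrite basis_vector_inr memv_span // map_f // mem_filter ar.
exact: valP.
Qed.

Lemma xvec_g_0 (a : seq_sub (Phi t n)) : has_type 0 0 (val a) ->
  basis_vector F (inr a : I) \in g_0 F t n.
Proof.
move=> ar; rewrite basis_vector_inr memv_span // mem_cat map_f // mem_filter ar.
exact: valP.
Qed.

(** For the center and the tips the type alone tells which subspace contains x_a; at a vertex the
    line has to be recorded as well. *)
Lemma root_cases (a : seq_sub (Phi t n)) : exists rs : int * int,
  [/\ has_type rs.1 rs.2 (val a), degree (inr a : I) = rs.1%:~R
    & rs \in (0, 0) :: star_tips \/
      rs \in star_vertices /\ basis_vector F (inr a : I) \in root_line F t n rs.1 rs.2].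
Proof.
have [/hasP[rs rsin ha]|/hasP[[r s] rsin /eqP ha]] := orP (Phi_type n_gt0 (valP a)).
  by exists rs; split=> //; [case/has_type_dot: ha | left].
have h := star_vertex_type n rsin; rewrite -ha in h.
exists (r, s); split=> //; first by case/has_type_dot: h.
by right; split=> //; rewrite basis_vector_inr [val a]ha memv_line.
Qed.

(** Identifies each announced grade with a coordinate subspace. One inclusion is checked summand by
    summand; the other uses [root_cases] for the x_a and [hgen_in_cartan_center] for the h_i. For
    |j| > 2 no basis vector has degree j. *)
Lemma magic_grading_supported j :
  magic_grading F t n j = supported F (has_degree j%:~R).
Proof.
apply/eqP; rewrite eqEsubv; apply/andP; split.
  rewrite /magic_grading; do ?case: eqP => [->|_].
  - rewrite !subv_add !line_hvec_supported // !tip_degree !andbT.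
    apply: subv_trans g_0_supported (supported_mono _).
    by case=> // b /has_type_dot[h _]; apply/eqP.
  - by rewrite !subv_add !tip_degree !root_line_degree.
  - by rewrite !subv_add !tip_degree !root_line_degree.
  - exact: root_line_degree.
  - exact: root_line_degree.
  - exact: sub0v.
apply: supported_subv => -[i|a]; rewrite /has_degree.
  rewrite /= eq_sym intr_eq0 => /eqP ->.
  have := hgen_in_cartan_center char0 n_gt0 i; rewrite /magic_grading /=.
  apply: subvP; apply: addvS => //; rewrite /g_III -addvA; exact: addvSl.
have [[r s] [ha -> /= rsin]] := root_cases a.
rewrite eqr_int => /eqP <-; have ht := xvec_tip ha; case: rsin => [|[]].
  rewrite inE => /orP[/eqP[er es]|].
    have: basis_vector F (inr a : I) \in g_0 F t n.
      by apply: xvec_g_0; move: ha; rewrite er es.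
    by rewrite er; apply: subvP; rewrite /magic_grading /=; solve_subv.
  rewrite !inE !xpair_eqE => rsin; move: rsin ht.
  do ![case/orP] => /andP[/eqP-> /eqP->]; apply: subvP; rewrite /magic_grading /=; solve_subv.
rewrite !inE !xpair_eqE.
do ![case/orP] => /andP[/eqP-> /eqP->]; apply: subvP; rewrite /magic_grading /=; solve_subv.
Qed.

Lemma bracket_basis_degree (p q : I) :
  bracket_basis F p q \in supported F (has_degree (degree p + degree q)).
Proof.
have xdeg (v : V) r : dot v (kvec n 1 - kvec n 2) = r ->
    xvec F t v \in supported F (has_degree r).
  by move=> vr; apply: mem_supported_xvec => a; rewrite /has_degree /= => ->; apply/eqP.
case: p q => [i|a] [j|b] /=; rewrite ?add0r ?addr0.
- exact: mem0v.
- by apply/memvZ/xdeg.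
- by rewrite memvN; apply/memvZ/xdeg.
case: eqP => [->|_].
  (* The product is a combination of the h_i, and the degrees of a root and its opposite cancel. *)
  rewrite memvN; apply: mem_supported_hvec => i.
  by rewrite /has_degree dotNl addNr eqxx.
case: ifP => _; last exact: mem0v.
by apply/memvZ/xdeg; rewrite dotDl.
Qed.

Lemma bracket_degree (r s : rat) (u v : L) :
  u \in supported F (has_degree r) -> v \in supported F (has_degree s) ->
  bracket u v \in supported F (has_degree (r + s)).
Proof.
move=> /memv_supported ur /memv_supported vs.
apply: memv_suml => p _; apply: memv_suml => q _.
have [/eqP <-|pr] := boolP (has_degree r p); last by rewrite ur // mul0r scale0r mem0v.
have [/eqP <-|qs] := boolP (has_degree s q); last by rewrite vs // mulr0 scale0r mem0v.
by apply/memvZ/bracket_basis_degree.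
Qed.

Lemma supported_predU (D D' : pred I) :
  supported F (predU D D') = (supported F D + supported F D')%VS.
Proof.
apply/eqP; rewrite eqEsubv subv_add !supported_mono ?andbT; last 2 first.
- by move=> p Dp; rewrite unfold_in /= [D' p]Dp orbT.
- by move=> p Dp; rewrite unfold_in /= [D p]Dp.
apply: supported_subv => p /orP[] Dp.
  exact: (subvP (addvSl _ _) _ (mem_supported_basis Dp)).
exact: (subvP (addvSr _ _) _ (mem_supported_basis Dp)).
Qed.

Lemma supported_disjoint (D D' : pred I) (u : L) : (forall p, D p -> ~~ D' p) ->
  u \in supported F D -> u \in supported F D' -> u = 0.
Proof.
move=> DD' /memv_supported uD /memv_supported uD'; apply/ffunP => p; rewrite ffunE.
by case: (boolP (D p)) => [/DD'|] Dp; [apply: uD' | apply: uD].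
Qed.

(** Different degrees select disjoint sets of basis vectors. The list is arbitrary so that both
    orderings of the five grades are covered. *)
Lemma degree_direct_sum (s : seq int) : uniq s ->
  is_direct_sum (supported F (fun p => degree p \in map intr s))
    [seq supported F (has_degree i%:~R) | i <- s].
Proof.
elim: s => [_|i s IH /= /andP[is_ us]].
  have -> : supported F (fun p => degree p \in [::]) = 0%VS.
    by apply/eqP; rewrite -subv0; apply: supported_subv.
  exact: is_direct_sum_nil.
apply: (is_direct_sum_cons (IH us)).
  by rewrite -supported_predU; congr (span (map _ _));
     apply: eq_enum => p; rewrite !unfold_in /= inE.
move=> u; apply: supported_disjoint => p /eqP ->.
by rewrite mem_map //; apply: intr_inj.
Qed.

Lemma degree_fullv (s : seq int) : {subset [:: -2; -1; 0; 1; 2] <= s} ->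
  supported F (fun p => degree p \in map intr s) = fullv.
Proof.
move=> hs; apply/eqP; rewrite eqEsubv subvf; apply/subvP => u _.
apply/memv_supported => -[i|a] /negP[].
  by apply/mapP; exists 0 => //; apply: hs.
have [[r r'] [_ -> /= rs]] := root_cases a; rewrite map_f //; apply: hs.
case: rs => [|[+ _]]; rewrite !inE !xpair_eqE;
  by do ![case/orP] => /andP[/eqP-> _].
Qed.

Lemma is_direct_sum_fullv (s : seq int) : uniq s ->
  {subset [:: -2; -1; 0; 1; 2] <= s} ->
  is_direct_sum fullv [seq magic_grading F t n i | i <- s].
Proof.
move=> us hs; rewrite (eq_map magic_grading_supported) -(degree_fullv hs).
exact: degree_direct_sum.
Qed.

Lemma five_grading_magic : five_grading (@bracket F t n) (magic_grading F t n).
Proof.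
split=> [i|| i j u v].
- rewrite /magic_grading; do ?case: eqP => [->|_] //.
- exact: is_direct_sum_fullv.
- rewrite !magic_grading_supported intrD; exact: bracket_degree.
Qed.

(** * Directness inside grade 0, and the final statements *)

Lemma pairing_supported w (D : pred I) (u : L) : (forall i, ~~ D (inl i)) ->
  u \in supported F D -> pairing w u = 0.
Proof.
move=> Dh /memv_supported uD; rewrite /pairing big1 // => i _.
by rewrite uD ?mul0r.
Qed.

Lemma ratr_intr_neq0 (z : int) : z != 0 -> ratr z%:~R != 0 :> F.
Proof. by move=> z0; rewrite pchar0_ratr_eq0 // intr_eq0. Qed.

(** Supports separate the tips from everything else. [g_0] and the line of h_w both involve the h_i,
    so they are separated by pairing with w = k_1 + k_2 - 2 k_3: it kills [g_0] and the tips, and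
    takes the value (w,w) = 6, nonzero in [F], on h_w. *)
Lemma g_III_direct_sum : is_direct_sum (g_III F t n)
  [:: g_0 F t n; <[hvec F t (kvec n 1 + kvec n 2 - 2%:R *: kvec n 3)%R]>%VS;
      tip F t n 0 2; tip F t n 0 (-2)].
Proof.
set w := (kvec n 1 + _ - _).
have tips v : v \in (tip F t n 0 2 + tip F t n 0 (-2))%VS ->
    v \in supported F (predU (is_root_of_type 0 2) (is_root_of_type 0 (-2))).
  by apply: subvP; rewrite supported_predU addvS ?tip_supported.
have type_inj (r s s' : int) (v : V) : has_type r s v -> has_type r s' v -> s = s'.
  by case/has_type_dot => _ h /has_type_dot[_ /eqP]; rewrite h eqr_int => /eqP.
rewrite /g_III -!addvA.
apply: is_direct_sum_cons => //; last first.
  move=> u u0 /memv_addP[_ /vlineP[c ->] [v vT eu]].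
  have vS := tips v vT; have: pairing w u = 0.
    by apply: (pairing_g_0 _ _ _ u0) => // a /has_type_dot[].
  have wE : pairing w (hvec F t w) = ratr 6%:~R.
    rewrite pairing_hvec //; last exact: kvecDB_root_lattice.
    by rewrite /w !dot_linearE !dot_kvec123.
  rewrite eu pairing_linear wE (pairing_supported _ _ vS) // addr0.
  move/eqP; rewrite mulf_eq0 (negPf (ratr_intr_neq0 _)) // orbF => /eqP c0.
  (* Without its h_w component, [u] lies both in [g_0] and in the sum of the tips, whose roots have
     different s. *)
  move: eu; rewrite c0 scale0r add0r => eu; rewrite -eu in vS *.
  apply: supported_disjoint vS (subvP g_0_supported _ u0) => -[|a] //= h.
  apply/negP => h'.
  by case/orP: h => h; have := type_inj _ _ _ _ h h'.
apply: is_direct_sum_cons => //; last first.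
  move=> u uh /tips.
  apply: supported_disjoint (subvP (@line_hvec_supported is_cartan _ _) _ uh) => //.
  by case.
apply: (@is_direct_sum_cons _ _ _ _ (tip F t n 0 (-2))) => //; last first.
  move=> u /(subvP (tip_supported _ _)) u1 /(subvP (tip_supported _ _)).
  apply: supported_disjoint u1 => -[|a] //= h; apply/negP => h'.
  by have := type_inj _ _ _ _ h h'.
apply: is_direct_sum_cons (is_direct_sum_nil _) _ _; first by rewrite addv0.
by move=> u _; rewrite memv0 => /eqP.
Qed.

(** Pairing with w = k_1 - k_2 vanishes on all four parts of [g_III], by orthogonality or for lack
    of h_i components, and takes the value (w,w) = 2 on h_w. *)
Lemma g_III_C_direct_sum : is_direct_sum (g_III F t n + C_part F t n)%VS
  [:: g_III F t n; C_part F t n].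
Proof.
set w := kvec n 1 - kvec n 2.
apply: (@is_direct_sum_cons _ _ _ _ (C_part F t n)) => //; last first.
  move=> u uIII /vlineP[c eu].
  have wE : pairing w (hvec F t w) = ratr 2%:~R.
    rewrite pairing_hvec //; last exact/Phi_root_lattice/kvecB_in_Phi.
    by rewrite /w !dot_linearE !dot_kvec123.
  suff: pairing w u = 0.
    rewrite eu pairingZ wE.
    move/eqP; rewrite mulf_eq0 (negPf (ratr_intr_neq0 _)) // orbF => /eqP ->;
     by rewrite scale0r.
  have [x /memv_addP[y /memv_addP[u0 u00 [_ /vlineP[d ->] ->]] [u1 u1T ->]] [u2 u2T ->]]
    := memv_addP uIII.
  have orth : dot (kvec n 1 + kvec n 2 - 2 *: kvec n 3) w = 0.
    by rewrite /w !dot_linearE !dot_kvec123.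
  have tip0 s v : v \in tip F t n 0 s -> pairing w v = 0.
    by move=> /(subvP (tip_supported _ _)); apply: pairing_supported.
  rewrite !pairingD pairingZ pairing_hvec // ?orth; last exact: kvecDB_root_lattice.
  rewrite (tip0 _ _ u1T) (tip0 _ _ u2T) (ratr_nat F 0) mulr0 !addr0.
  by apply: (pairing_g_0 _ _ _ u00) => // v /has_type_dot[].
apply: is_direct_sum_cons (is_direct_sum_nil _) _ _; first by rewrite addv0.
by move=> u _; rewrite memv0 => /eqP.
Qed.

Lemma degree_decomposition : is_direct_sum fullv
  [:: (g_III F t n + C_part F t n)%VS; Fplus F t n; Fminus F t n;
      root_line F t n 2 0; root_line F t n (-2) 0].
Proof.
apply: (@is_direct_sum_fullv [:: 0; 1; -1; 2; -2]) => // i; rewrite !inE.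
by do ![case/orP] => /eqP ->.
Qed.

Lemma subalgebra_degree0 : subalgebra (@bracket F t n) (g_III F t n + C_part F t n)%VS.
Proof.
have [_ _ br] := five_grading_magic.
by move=> u v; apply: (br 0 0).
Qed.

End Grading.

Theorem proposition3p2 (F : fieldType) (t : magic_type) (n : nat) :
  [pchar F] =i pred0 -> (1 <= n)%N ->
  [/\ is_direct_sum (g_III F t n)
        [:: g_0 F t n;
            <[hvec F t (kvec n 1 + kvec n 2 - 2%:R *: kvec n 3)%R]>%VS;
            tip F t n 0 2; tip F t n 0 (-2)],
      is_direct_sum (g_III F t n + C_part F t n)%VS
        [:: g_III F t n; C_part F t n],
      is_direct_sum fullv
        [:: (g_III F t n + C_part F t n)%VS; Fplus F t n; Fminus F t n;
            root_line F t n 2 0; root_line F t n (-2) 0],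
      subalgebra (@bracket F t n) (g_III F t n + C_part F t n)%VS
    & five_grading (@bracket F t n) (magic_grading F t n)].
Proof.
move=> char0 n_gt0; split.
- exact: g_III_direct_sum.
- exact: g_III_C_direct_sum.
- exact: degree_decomposition.
- exact: subalgebra_degree0.
- exact: five_grading_magic.
Qed.
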